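(* Let $f:\mathbb{T}^2\to\mathbb{T}^2$ be a $C^2$ Anosov endomorphism with constant Jacobian $|\det Df|$ whose unstable foliation has the UBD property, and let $F$, $\mathcal B_k$ and $m^k_x$ be as in the context. Then for every $k\ge 0$ and for $m$-almost every $x\in\mathcal B_k$, $$\frac{d m^k_x}{d\left(F^k_* m^0_{F^{-k}(x)}\right)}=1 .$$
   Context: Anosov endomorphism: a local $C^1$ diffeomorphism $f:M\to M$ of a closed Riemannian manifold such that for every full orbit $\tilde x=(x_i)_{i\in\mathbb{Z}}$ ($f(x_i)=x_{i+1}$) there is a splitting $T_{x_i}M=E^u(x_i)\oplus E^s(x_i)$, with $Df(x_i)E^{\sigma}(x_i)=E^{\sigma}(x_{i+1})$, and constants $c>0$, $\lambda>1$ such that for all $n\ge 0$ and all $i$: $\|Df^n(x_i)v\|\ge c^{-1}\lambda^n\|v\|$ for $v\in E^u(x_i)$ and $\|Df^n(x_i)v\|\le c\lambda^{-n}\|v\|$ for $v\in E^s(x_i)$. Standing convention: $E^s$ is nontrivial, so on $\mathbb{T}^2$ both $E^s$ and $E^u$ are one-dimensional. UBD property: a one-dimensional foliation $\mathcal F$ has the uniform bounded density property if there is $C>1$ such that, for every foliated box $\mathcal B$, the disintegration $\{m^{\mathcal B}_x\}$ of the volume normalized to $\mathcal B$ along local leaves satisfies $C^{-1}\le \frac{d m^{\mathcal B}_x}{d\hat\lambda^{\mathcal B}_x}\le C$, where $\hat\lambda^{\mathcal B}_x$ is the normalized length on the connected component of $\mathcal F(x)\cap\mathcal B$ containing $x$.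 For the unstable foliation of $f$ this means: the unstable foliation $W^u_F$ of a lift $F$ has it. Setting. $F:\mathbb{R}^2\to\mathbb{R}^2$ is a lift of $f$ (an Anosov diffeomorphism, with stable and unstable foliations $W^s_F$, $W^u_F$ having global product structure), normalized so that $F(0)=0$ and assumed to preserve the orientation of unstable leaves. $p:\mathbb{R}^2\to\mathbb{T}^2$ is the projection and $m$ is Lebesgue measure on $\mathbb{R}^2$. Let $B=W^s_F(0)$ ($F$-invariant, met by each unstable leaf at exactly one point), and $p^u_F:\mathbb{R}^2\to B$, $p^u_F(z)=W^u_F(z)\cap B$. Choose one side of $B$ as positive, and let $W^{u,+}_F$ denote the part of the unstable leaves on that side. Let $\delta_0>0$ be such that $\mathcal B_0=\{y\in W^{u,+}_F: d^u(p^u_F(y),y)\le\delta_0\}$ satisfies $p(\mathcal B_0)=\mathbb{T}^2$, where $d^u$ is distance along unstable leaves. Let $\mathcal B_k=F^k(\mathcal B_0)$ and $W_k(x)=W^u_F(x)\cap\mathcal B_k$. For $m$-almost every $x\in\mathcal B_k$, $m^k_x$ is the conditional probability measure on $W_k(x)$ obtained by disintegrating $m$, restricted to foliated boxes of the form $(p^u_F|_{\mathcal B_k})^{-1}(Y)$ with $Y\subset B$ a bounded open set and normalized, along the leaf segments $W_k(\cdot)$; it is uniquely determined for almost every leaf. *)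

(* Defs.v *)
From HB Require Import structures.
From mathcomp Require Import all_boot all_order all_algebra generic_quotient.
From mathcomp Require Import all_classical all_reals all_analysis.
From mathcomp Require Import measurable_realfun.

Set Implicit Arguments.
Unset Strict Implicit.
Unset Printing Implicit Defensive.

Import Order.TTheory GRing.Theory Num.Theory.
Import numFieldNormedType.Exports.

Local Open Scope classical_set_scope.
Local Open Scope ring_scope.
Local Open Scope charge_scope.

(* The library's Lebesgue measure lives on [measurableTypeR R], so measures on
   the plane are taken on [mplane R]; the two types are convertible.  The
   canonical norm of [plane R] is the sup norm; it is only used for topological
   notions, and lengths are measured with [enorm]. *)
Notation plane R := (R * R)%type.
Notation mplane R := (measurableTypeR R * measurableTypeR R)%type.

Definition area {R : realType} : {measure set (mplane R) -> \bar R} :=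
  (@lebesgue_measure R \x @lebesgue_measure R)%E.

Definition enorm {R : realType} (v : plane R) : R :=
  Num.sqrt (v.1 ^+ 2 + v.2 ^+ 2).

Definition det2 {R : realType} (L : plane R -> plane R) : R :=
  (L (1, 0)).1 * (L (0, 1)).2 - (L (0, 1)).1 * (L (1, 0)).2.

Definition C1 {R : realType} (g : plane R -> plane R) : Prop :=
  (forall z, differentiable g z) /\ forall v, continuous (fun z => 'd g z v).

Definition C2 {R : realType} (g : plane R -> plane R) : Prop :=
  C1 g /\ forall v, C1 (fun z => 'd g z v : plane R).

Definition Z2_rel {R : realType} (z w : plane R) : bool :=
  `[< exists a b : int, z - w = (a%:~R, b%:~R) >].

Lemma Z2_rel_refl {R : realType} : reflexive (@Z2_rel R).
Proof. by move=> z; apply/asboolP; exists 0, 0; rewrite subrr. Qed.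

Lemma Z2_rel_sym {R : realType} : symmetric (@Z2_rel R).
Proof.
suff H (z w : plane R) : Z2_rel z w -> Z2_rel w z.
  by move=> z w; apply/idP/idP; exact: H.
move=> /asboolP[a [b zw]]; apply/asboolP; exists (- a), (- b).
by rewrite -opprB zw !mulrNz.
Qed.

Lemma Z2_rel_trans {R : realType} : transitive (@Z2_rel R).
Proof.
move=> y x z /asboolP[a [b xy]] /asboolP[c [d yz]].
apply/asboolP; exists (a + c), (b + d).
by rewrite -(subrKA y) xy yz !intrD.
Qed.

Canonical Z2_equiv (R : realType) : equiv_rel (plane R) :=
  EquivRel (@Z2_rel R) Z2_rel_refl Z2_rel_sym Z2_rel_trans.

Definition torus (R : realType) := {eq_quot (Z2_equiv R)}%qT.

Definition torus_proj {R : realType} (z : plane R) : torus R :=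
  (\pi_(torus R) z)%qT.

(* The torus carries the smooth structure and the flat metric for which
   [torus_proj] is a local isometry, so a torus map is C^k iff its lift is. *)
Definition lift_of {R : realType} (f : torus R -> torus R)
    (F : plane R -> plane R) : Prop :=
  continuous F /\ forall z, torus_proj (F z) = f (torus_proj z).

Definition torus_C1 {R : realType} (f : torus R -> torus R) : Prop :=
  exists2 F, lift_of f F & C1 F.

Definition torus_C2 {R : realType} (f : torus R -> torus R) : Prop :=
  exists2 F, lift_of f F & C2 F.

(* Every tangent space of the torus is identified with [R^2] by [torus_proj].
   The result depends neither on the lift nor on the representative of [x],
   since two lifts differ by an integer vector and [F (z + n) - F z] does not
   depend on [z] for integer [n]. *)
Definition torus_D {R : realType} (f : torus R -> torus R) (x : torus R) :
    plane R -> plane R :=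
  'd (get [set F : plane R -> plane R | lift_of f F]) (repr x).

Definition Anosov_endomorphism {R : realType} (f : torus R -> torus R) : Prop :=
  [/\ torus_C1 f,
      forall x, det2 (torus_D f x) != 0 &
      exists c lam : R, [/\ 0 < c, 1 < lam &
        forall x : int -> torus R, (forall i, f (x i) = x (i + 1)) ->
        exists Eu Es : int -> {vspace (plane R)}, forall i,
        [/\ (Eu i + Es i)%VS = fullv /\ (Eu i :&: Es i)%VS = 0%VS,
            \dim (Eu i) = 1%N /\ \dim (Es i) = 1%N,
            torus_D f (x i) @` [set` Eu i] = [set` Eu (i + 1)] /\
            torus_D f (x i) @` [set` Es i] = [set` Es (i + 1)],
            forall (n : nat) v, v \in Eu i ->
              c^-1 * lam ^+ n * enorm v <= enorm (torus_D (iter n f) (x i) v) &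
            forall (n : nat) v, v \in Es i ->
              enorm (torus_D (iter n f) (x i) v) <= c * lam ^- n * enorm v]]].

(* A foliation of the plane is represented by the map sending each point to its
   leaf.
   Stable manifold of [z] for [F]; the unstable manifolds of an invertible [F]
   are the stable manifolds of its inverse. *)
Definition stable_leaf {R : realType} (F : plane R -> plane R) (z : plane R) :
    set (plane R) :=
  [set w | (fun n => iter n F w - iter n F z) @ \oo --> (0 : plane R)].

Definition global_product_structure {R : realType}
    (Ws Wu : plane R -> set (plane R)) : Prop :=
  forall z w, exists y, Wu z `&` Ws w = [set y].

Definition arclength_param {R : realType} (L : set (plane R))
    (g : R -> plane R) : Prop :=
  [/\ injective g, range g = L, forall t, derivable g t 1,
      continuous (derive1 g) & forall t, enorm (derive1 g t) = 1].

Definition leaf_param {R : realType} (L : set (plane R)) : R -> plane R :=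
  get [set g | arclength_param L g].

Definition leaf_dist {R : realType} (L : set (plane R)) (x y : plane R) : R :=
  let g := leaf_param L in
  `|get (g @^-1` [set x]) - get (g @^-1` [set y])|.

Definition leaf_length {R : realType} (L : set (plane R)) (A : set (mplane R)) :
    \bar R :=
  pushforward lebesgue_measure (leaf_param L : measurableTypeR R -> mplane R) A.

(* A continuous nonvanishing field [e] tangent to the leaves is an orientation
   of the leaves. *)
Definition preserves_leaf_orientation {R : realType}
    (W : plane R -> set (plane R)) (F : plane R -> plane R) : Prop :=
  exists e : plane R -> plane R,
  [/\ continuous e,
      forall z t, exists2 a : R, a != 0 &
        e (leaf_param (W z) t) = a *: derive1 (leaf_param (W z)) t &
      forall z, exists2 a : R, 0 < a & 'd F z (e z) = a *: e (F z)].

Definition open_square {R : realType} : set (plane R) :=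
  [set z | 0 < z.1 < 1 /\ 0 < z.2 < 1].

(* The plaques [phi (]0, 1[ x {t})] are then the connected components of the
   traces of the leaves on [U].  Boundedness gives [U] a finite area. *)
Definition foliated_box {R : realType} (W : plane R -> set (plane R))
    (U : set (plane R)) : Prop :=
  [/\ open U, bounded_set U &
    exists phi psi : plane R -> plane R,
    [/\ phi @` open_square = U,
        {in open_square, cancel phi psi},
        {in open_square, continuous phi},
        {in U, continuous psi} &
        forall s s' t, open_square (s, t) -> open_square (s', t) ->
          W (phi (s, t)) (phi (s', t))]].

Definition normalized {R : realType} (m : set (mplane R) -> \bar R)
    (U A : set (mplane R)) : \bar R :=
  (m (A `&` U) / m U)%E.

(* [mu] is a system of conditional measures of the normalized area of [U] along
   the partition of [U] into the sets [W x].  Existence of the probability [P]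
   forces the area of [U] to be positive and finite. *)
Definition disintegrates {R : realType} (U : set (mplane R))
    (W : mplane R -> set (mplane R))
    (mu : mplane R -> probability (mplane R) R) : Prop :=
  measurable U /\
  exists P : probability (mplane R) R,
  [/\ forall A, measurable A -> P A = normalized area U A,
      forall A, measurable A -> measurable_fun U (fun x => mu x A),
      {ae P, forall x, (mu x).-negligible (~` W x) /\
        forall y, W x y -> forall A, measurable A -> mu y A = mu x A} &
      forall A, measurable A -> P A = (\int[P]_(x in U) mu x A)%E].

(* The measure [mu] is absolutely continuous with respect to the probability
   [lam] and its density satisfies [Q] almost everywhere. *)
Definition density_ae {R : realType} (mu : probability (mplane R) R)
    (lam : set (mplane R) -> \bar R) (Q : \bar R -> Prop) : Prop :=
  exists nu : probability (mplane R) R,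
  [/\ forall A, measurable A -> nu A = lam A,
      mu `<< nu &
      {ae nu, forall y,
        Q (('d (charge_of_finite_measure mu) '/d nu) y)}].

Definition UBD {R : realType} (W : plane R -> set (plane R)) : Prop :=
  exists2 C : R, 1 < C & forall U, foliated_box W U ->
  let plaque x := connected_component (W x `&` U) x in
  exists2 mu : mplane R -> probability (mplane R) R,
    disintegrates U plaque mu &
    {ae area, forall x, U x ->
      density_ae (mu x) (normalized (leaf_length (W x)) (plaque x))
        (fun r => (C^-1%:E <= r <= C%:E)%E)}.

Definition proj_u {R : realType} (B : set (plane R))
    (Wu : plane R -> set (plane R)) (z : plane R) : plane R :=
  get (Wu z `&` B).

(* The part of the leaves on the side [S] of [B] is taken to contain its base
   points on [B]. *)
Definition strip0 {R : realType} (B S : set (plane R))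
    (Wu : plane R -> set (plane R)) (delta : R) : set (plane R) :=
  [set y | (S `|` B) y /\ leaf_dist (Wu y) (proj_u B Wu y) y <= delta].

(* Main.v *)
(* On a box saturated by unstable segments, the conditional measures of the
   area are unique up to a null set of leaves.  The lift [F] maps such a box at
   level [0] onto one at level [k], maps leaves to leaves, and, its Jacobian
   being constant, multiplies the area by a constant; so [F^k] transports a
   disintegration of the normalized area of the first box to one of the second,
   and uniqueness gives the equality.

   The area formula is proved from pointwise differentiability of [F] and
   continuity of its inverse: a rectangle and its image are compared by repeated
   quartering down to a point, where the first order expansion decides.  The
   inverse is continuous since [F] is at bounded distance from an injective
   linear map, hence proper. *)

Require Import Defs.
From HB Require Import structures.
From mathcomp Require Import all_boot all_order all_algebra.
From mathcomp Require Import all_classical all_reals all_analysis.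
From mathcomp Require Import measurable_realfun.
From mathcomp Require Import ring lra.

Set Implicit Arguments.
Unset Strict Implicit.
Unset Printing Implicit Defensive.

Import Order.TTheory GRing.Theory Num.Theory.
Import numFieldNormedType.Exports.

Local Open Scope classical_set_scope.
Local Open Scope ring_scope.

(** * Rational rectangles generate the Borel sets of the plane *)

Definition rect {R : realType} (a b c d : R) : set (mplane R) :=
  `]a, b] `*` `]c, d].

Definition ratrect {R : realType} (n : nat) : set (mplane R) :=
  if unpickle n is Some (a, b, c, d) then
    rect (ratr a) (ratr b) (ratr c) (ratr d)
  else set0.

Lemma rectP {R : realType} (a b c d : R) (z : mplane R) :
  rect a b c d z <-> [/\ a < z.1, z.1 <= b, c < z.2 & z.2 <= d].
Proof.
rewrite /rect /= !in_itv /=; split; first by case=> /andP[-> ->] /andP[-> ->].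
by case=> -> -> -> ->.
Qed.

Lemma rectI {R : realType} (a b c d a' b' c' d' : R) :
  rect a b c d `&` rect a' b' c' d' =
  rect (Num.max a a') (Num.min b b') (Num.max c c') (Num.min d d').
Proof.
apply/seteqP; split => z /=; rewrite !rectP.
  by case=> -[a1 b1 c1 d1] [a2 b2 c2 d2]; rewrite !gt_max !le_min; split; lra.
rewrite !gt_max !le_min => -[/andP[? ?] /andP[? ?] /andP[? ?] /andP[? ?]].
by [].
Qed.

Lemma ratr_max {R : realType} (a b : rat) :
  (ratr (Num.max a b) : R) = Num.max (ratr a) (ratr b).
Proof. by rewrite !maxEle ler_rat; case: ifP. Qed.

Lemma ratr_min {R : realType} (a b : rat) :
  (ratr (Num.min a b) : R) = Num.min (ratr a) (ratr b).
Proof. by rewrite !minEle ler_rat; case: ifP. Qed.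

Lemma ratrect_setI {R : realType} : setI_closed (range (@ratrect R)).
Proof.
have rr p q : range (@ratrect R)
    (rect (ratr p.1) (ratr p.2) (ratr q.1) (ratr q.2)).
  by exists (pickle (p, q.1, q.2)) => //; rewrite /ratrect pickleK; case: p.
have rr0 : range (@ratrect R) set0.
  suff -> : set0 = rect (ratr 1) (ratr 0) (ratr 1) (ratr 0) :> set (mplane R).
    exact: (rr (1, 0) (1, 0)).
  apply/esym/seteqP; split => // z /rectP[+ /(lt_le_trans _)] => /[swap] /[apply].
  by rewrite ltr_rat.
move=> _ _ [m _ <-] [n _ <-]; rewrite /ratrect.
case: unpickle => [[[[a b] c] d]|]; last by rewrite set0I.
case: unpickle => [[[[a' b'] c'] d']|]; last by rewrite setI0.
rewrite rectI -!ratr_max -!ratr_min.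
exact: (rr (_, _) (_, _)).
Qed.

Lemma ratrect_basis {R : realType} (z : plane R) (e : R) : 0 < e ->
  exists2 n, ratrect n z & ratrect n `<=` (ball z e : set (plane R)).
Proof.
move=> e0.
have near_rat (x : R) : exists p q : rat,
    [/\ ratr p < x, x <= ratr q, x - e < ratr p & ratr q < x + e].
  have /rat_in_itvoo[p] : x - e < x by lra.
  have /rat_in_itvoo[q] : x < x + e by lra.
  rewrite !in_itv /= => /andP[h1 h2] /andP[h3 h4].
  by exists p, q; split => //; exact: ltW.
have [a [b [az zb ea be]]] := near_rat z.1.
have [c [d [cz zd ec de]]] := near_rat z.2.
exists (pickle (a, b, c, d)); rewrite /ratrect pickleK; first exact/rectP.
move=> w /rectP[aw wb cw wd].
by split; rewrite /ball /= ltr_norml; lra.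
Qed.

Lemma ratrect_measurable {R : realType} (n : nat) :
  measurable (@ratrect R n).
Proof.
rewrite /ratrect; case: unpickle => [[[[a b] c] d]|]; last exact: measurable0.
by apply: measurableX; exact: measurable_itv.
Qed.

Lemma open_g_ratrect {R : realType} (A : set (plane R)) : open A ->
  <<s range (@ratrect R) >> A.
Proof.
move=> oA.
have -> : A = \bigcup_n
    (if `[< ratrect n `<=` A >] then ratrect n else set0 : set (mplane R)).
  apply/seteqP; split=> [z Az|z [n _]]; last by case: asboolP => // rA /rA.
  have /nbhs_ballP[e /= e0 eA] : nbhs z A by exact: open_nbhs_nbhs.
  have [n nz nA] := ratrect_basis z e0.
  by exists n => //; rewrite asboolT // => w /nA/eA.
apply: sigma_algebra_bigcup => n; case: asboolP => _.
  by apply: sub_sigma_algebra; exists n.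
exact: sigma_algebra0.
Qed.

Lemma continuous_g_ratrect {R : realType} (g : plane R -> R) (y : R) :
  continuous g -> <<s range (@ratrect R) >> (g @^-1` `]-oo, y[).
Proof.
by move=> cg; apply: open_g_ratrect; apply: open_comp => //; exact: lray_open.
Qed.

Lemma measurable_planeE {R : realType} :
  measurable = <<s range (@ratrect R) >>.
Proof.
apply/seteqP; split; last first.
  apply: smallest_sub; first exact: sigma_algebra_measurable.
  by move=> _ [n _ <-]; exact: ratrect_measurable.
apply: smallest_sub; first exact: smallest_sigma_algebra.
rewrite subUset; split => _ [A mA <-].
- have := @measurability _ _ (g_sigma_algebraType (range (@ratrect R)))
    (measurableTypeR R) setT fst _ (RGenInftyO.measurableE R).
  apply => // _ [_ [y ->] <-]; rewrite setTI.
  by apply: continuous_g_ratrect => z; exact: cvg_fst.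
- have := @measurability _ _ (g_sigma_algebraType (range (@ratrect R)))
    (measurableTypeR R) setT snd _ (RGenInftyO.measurableE R).
  apply => // _ [_ [y ->] <-]; rewrite setTI.
  by apply: continuous_g_ratrect => z; exact: cvg_snd.
Qed.

Lemma open_measurable_plane {R : realType} (A : set (plane R)) :
  open A -> measurable (A : set (mplane R)).
Proof. by rewrite measurable_planeE; exact: open_g_ratrect. Qed.

Lemma continuous_measurable_plane {R : realType} (g : plane R -> plane R) :
  continuous g -> measurable_fun setT (g : mplane R -> mplane R).
Proof.
move=> cg; apply/measurable_fun_pairP; split;
  apply: (measurability _ (RGenInftyO.measurableE R)) => _ [_ [y ->] <-];
  rewrite setTI; apply: open_measurable_plane; apply: open_comp (lray_open y);
  move=> z _; apply: continuous_comp (cg z) _.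
- exact: cvg_fst.
- exact: cvg_snd.
Qed.

(** * Uniqueness of disintegrations *)

Section disintegration_unique.
Variables (R : realType) (U : set (mplane R)) (P : probability (mplane R) R).
Variable W : mplane R -> set (mplane R).
Hypotheses (mU : measurable U) (PU : P (~` U) = 0%E).
Hypothesis WU : forall x y, U x -> W x y -> U y.

Definition kernel_along (mu : mplane R -> probability (mplane R) R) :=
  [/\ forall A, measurable A -> measurable_fun U (fun x => mu x A),
      {ae P, forall x, (mu x).-negligible (~` W x) /\
        forall y, W x y -> forall A, measurable A -> mu y A = mu x A} &
      forall A, measurable A -> P A = (\int[P]_(x in U) mu x A)%E].

(* A leafwise constant condition on [x] defines a set [C] saturated by leaves,
   for which [mu x (A `&` C)] is [mu x A] or [0] according to [x \in C]. *)
Lemma integral_saturated (mu : mplane R -> probability (mplane R) R)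
    (A C : set (mplane R)) :
  kernel_along mu -> measurable A -> measurable C -> C `<=` U ->
  {ae P, forall x, forall y, U x -> W x y -> C y <-> C x} ->
  P (A `&` C) = (\int[P]_(x in C) mu x A)%E.
Proof.
move=> [mmu aemu Pmu] mA mC CU sC.
have mAC : measurable (A `&` C) by exact: measurableI.
rewrite Pmu //.
rewrite -[in RHS](setIidr CU) integral_mkcondr; apply: ae_eq_integral => //.
- exact: mmu.
- by apply/(measurable_restrict _ mC mU); apply: measurable_funS (mmu _ mA).
apply: filterS2 aemu sC => x [negW _] sC Ux; rewrite patchE.
have [N [mN N0 WN]] := negW.
case: ifPn => [/set_mem Cx|/negP xC].
  apply/eqP; rewrite eq_le le_measure ?inE//=.
  rewrite (le_trans (le_measure (mu x) _ _ (_ : A `<=` (A `&` C) `|` N)))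
    ?inE//; first exact: measurableU.
    move=> y Ay; have [Wy|Wy] := pselect (W x y); last by right; exact: WN.
    by left; split => //; exact/(sC _ Ux Wy).
  apply: le_trans (measureU2 _ _ _) _ => //.
  by rewrite [X in (_ + X <= _)%E]N0 adde0.
rewrite (_ : point = 0%E) //; apply/eqP; rewrite eq_le measure_ge0 andbT.
rewrite -[leRHS]N0 le_measure ?inE// => y [Ay Cy]; apply: WN => Wy; apply: xC.
apply/mem_set.
exact/(sC _ Ux Wy).
Qed.

Lemma kernel_along_le (mu nu : mplane R -> probability (mplane R) R)
    (A : set (mplane R)) :
  kernel_along mu -> kernel_along nu -> measurable A ->
  P (U `&` [set x | (nu x A < mu x A)%E]) = 0%E.
Proof.
move=> hmu hnu mA; have [mmu aemu _] := hmu; have [mnu aenu _] := hnu.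
set C := (X in P X).
have mC : measurable C by exact: measurable_lte (mnu _ mA) (mmu _ mA).
have CU : C `<=` U by move=> x [].
have sC : {ae P, forall x, forall y, U x -> W x y -> C y <-> C x}.
  apply: filterS2 aemu aenu => x [_ mux] [_ nux] y Ux Wy.
  rewrite /C /= (mux _ Wy _ mA) (nux _ Wy _ mA); split=> -[_ ?]; split=> //.
  exact: WU Wy.
have int_le1 (m : mplane R -> probability (mplane R) R) :
    (forall A, measurable A -> measurable_fun U (fun x => m x A)) ->
    P.-integrable C (fun x => m x A).
  move=> mm; apply: (le_integrable mC (g := EFin \o cst 1)).
  - exact: measurable_funS (mm _ mA).
  - by move=> x _ /=; rewrite gee0_abs // normr1; exact: probability_le1.
  - exact: finite_measure_integrable_cst.
have I0 : (\int[P]_(x in C) `|mu x A - nu x A| = 0)%E.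
  under eq_integral => x /set_mem[_ /= lt].
    rewrite gee0_abs; last by rewrite sube_ge0 ?ltW // fin_num_measure.
    over.
  rewrite integralB //; [|exact: int_le1..].
  by rewrite -!integral_saturated // subee // fin_num_measure //; exact: measurableI.
have /(ae_eq_integral_abs P mC) : measurable_fun C (fun x => mu x A - nu x A)%E.
  by apply: emeasurable_funB; [apply: measurable_funS (mmu _ mA)|
    apply: measurable_funS (mnu _ mA)].
move=> /iffLR /(_ I0) [N [mN N0 CN]].
apply/eqP; rewrite eq_le measure_ge0 andbT -N0 le_measure ?inE//.
move=> x Cx; apply: CN => /= /(_ Cx) /eqP.
case: Cx => _ /= lt; rewrite sube_eq ?fin_num_measure// ?fin_num_adde_defl//.
by rewrite add0e gt_eqF.
Qed.

Lemma kernel_along_unique (mu nu : mplane R -> probability (mplane R) R) :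
  kernel_along mu -> kernel_along nu ->
  {ae P, forall x, forall A, measurable A -> mu x A = nu x A}.
Proof.
move=> hmu hnu.
have : {ae P, forall x, forall n, mu x (ratrect n) = nu x (ratrect n)}.
  apply: ae_foralln => n; have mn := @ratrect_measurable R n.
  have [mmu _ _] := hmu; have [mnu _ _] := hnu.
  exists (~` U `|` ((U `&` [set x | (nu x (ratrect n) < mu x (ratrect n))%E]) `|`
    (U `&` [set x | (mu x (ratrect n) < nu x (ratrect n))%E]))).
  have m1 : measurable (U `&` [set x | (nu x (ratrect n) < mu x (ratrect n))%E]).
    exact: measurable_lte (mnu _ mn) (mmu _ mn).
  have m2 : measurable (U `&` [set x | (mu x (ratrect n) < nu x (ratrect n))%E]).
    exact: measurable_lte (mmu _ mn) (mnu _ mn).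
  split.
  - by apply: measurableU; [exact: measurableC|exact: measurableU].
  - rewrite measureU0 //; [exact: measurableC|exact: measurableU|].
    by rewrite measureU0 //; exact: kernel_along_le.
  - move=> x /= /eqP; have [Ux|nUx _] := pselect (U x); last by left.
    by rewrite neq_lt => /orP[lt|lt]; right; [right|left].
apply: filterS => x eqx A mA.
apply: (measure_unique (range (@ratrect R)) (@ratrect R)) => //.
- exact: measurable_planeE.
- exact: ratrect_setI.
- apply/seteqP; split => // z _.
  by have [n nz _] := ratrect_basis z (@ltr01 R); exists n.
- by move=> _ [n _ <-]; exact: eqx.
- by move=> n; rewrite ltey_eq fin_num_measure //; exact: ratrect_measurable.
Qed.

End disintegration_unique.

Lemma disintegrates_unique {R : realType} (U : set (mplane R))
    (W : mplane R -> set (mplane R))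
    (mu nu : mplane R -> probability (mplane R) R) :
  (forall x y, U x -> W x y -> U y) ->
  disintegrates U W mu -> disintegrates U W nu ->
  {ae area, forall x, U x -> forall A, measurable A -> mu x A = nu x A}.
Proof.
move=> WU [mU [P [PE mmu aemu Pmu]]] [_ [Q [QE mnu aenu Qnu]]].
have PQ A : measurable A -> P A = Q A by move=> mA; rewrite PE // QE.
have PU : P (~` U) = 0%E.
  rewrite PE; last exact: measurableC.
  by rewrite /normalized setICl measure0 mul0e.
have hmu : kernel_along U P W mu by [].
have hnu : kernel_along U P W nu.
  split => //.
    have [N [mN N0 sN]] := aenu; exists N; split => //.
    by rewrite [LHS]PQ.
  move=> A mA; rewrite PQ // Qnu //; apply: eq_measure_integral => B mB _.
  by rewrite [RHS]PQ.
have [N [mN N0 sN]] := kernel_along_unique mU PU WU hmu hnu.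
exists (N `&` U); split; first exact: measurableI.
  have aU : ((area U)^-1 != 0)%E.
    apply/eqP => aU0; have := PE _ measurableT; rewrite /normalized aU0 mule0.
    by rewrite probability_setT => /eqP; rewrite onee_eq0.
  move: N0; rewrite PE // => /eqP.
  by rewrite mule_eq0 (negbTE aU) orbF => /eqP.
move=> x /= /not_implyP[Ux neq]; split => //.
by apply: sN => /= eqx; apply: neq => A mA; rewrite eqx.
Qed.

(** * Affine maps and area *)

Lemma lebesgue_measure_affine {R : realType} (a b : R)
    (A : set (measurableTypeR R)) : a != 0 -> measurable A ->
  (`|a|%:E * lebesgue_measure
     ((fun y => (a * y + b)%R : measurableTypeR R) @^-1` A : set (measurableTypeR R)))%E =
  lebesgue_measure A.
Proof.
move=> a0 mA; pose h (y : measurableTypeR R) : measurableTypeR R := a * y + b.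
have mh : measurable_fun setT h.
  apply: measurable_funD; last exact: measurable_cst.
  by apply: measurable_funM => //; exact: measurable_cst.
have a1 : 0 <= `|a| by [].
pose m : {measure set (measurableTypeR R) -> \bar R} :=
  mscale (NngNum a1) (pushforward lebesgue_measure h).
apply/esym; rewrite (lebesgue_measure_unique (mu := m mh)) //.
move=> _ [[c d] _ <-] /=.
change (lebesgue_measure (`]c, d] : set R) =
  `|a|%:E * lebesgue_measure (h @^-1` `]c, d] : set R))%E.
have [a_lt0|a_gt0|/eqP] := ltgtP a 0; last by rewrite (negbTE a0).
- rewrite ltr0_norm //.
  have -> : h @^-1` `]c, d] = `[(d - b) / a, (c - b) / a[%classic.
    apply/seteqP; split => y /=; rewrite !in_itv /= /h ler_ndivrMr // ltr_ndivlMr //; lra.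
  rewrite !lebesgue_measure_itv /= !lte_fin ltr_ndivlMr // divfK // ltrD2r.
  case: ifPn => cd; last by rewrite mule0.
  by rewrite -!EFinB -EFinM; congr EFin; field.
- rewrite gtr0_norm //.
  have -> : h @^-1` `]c, d] = `](c - b) / a, (d - b) / a]%classic.
    apply/seteqP; split => y /=; rewrite !in_itv /= /h ler_pdivlMr // ltr_pdivrMr //; lra.
  rewrite !lebesgue_measure_itv /= !lte_fin ltr_pdivlMr // divfK // ltrD2r.
  case: ifPn => cd; last by rewrite mule0.
  by rewrite -!EFinB -EFinM; congr EFin; field.
Qed.

Lemma area_ysection {R : realType} (A : set (mplane R)) : measurable A ->
  area A = (\int[lebesgue_measure]_y lebesgue_measure (ysection A y))%E.
Proof.
by move=> mA; apply: (product_measure_unique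
  (m' := (@lebesgue_measure R \x^ @lebesgue_measure R)%E)) => // X Y mX mY;
  exact: product_measure2E.
Qed.

Definition affine {R : realType} (p q r s t u : R) (z : mplane R) : mplane R :=
  (p * z.1 + q * z.2 + t, r * z.1 + s * z.2 + u).

Lemma affine_measurable {R : realType} (p q r s t u : R) :
  measurable_fun setT (affine p q r s t u).
Proof.
apply: continuous_measurable_plane => z; rewrite /affine.
have lin (a b c : R) : (fun z : plane R => a * z.1 + b * z.2 + c) @ z -->
    (a * z.1 + b * z.2 + c).
  apply: cvgD; last exact: cvg_cst.
  by apply: cvgD; apply: cvgM; (exact: cvg_cst || exact: cvg_fst || exact: cvg_snd).
exact: (cvg_pair (lin _ _ _) (lin _ _ _)).
Qed.

Lemma affine_preimage_measurable {R : realType} (p q r s t u : R)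
    (A : set (mplane R)) : measurable A -> measurable (affine p q r s t u @^-1` A).
Proof. by move=> mA; rewrite -[X in measurable X]setTI; exact: affine_measurable. Qed.

Lemma area_shear2 {R : realType} (r s u : R) (A : set (mplane R)) :
  s != 0 -> measurable A ->
  (`|s|%:E * area (affine 1 0 r s 0 u @^-1` A))%E = area A.
Proof.
move=> s0 mA; rewrite /area /product_measure1 -ge0_integralZl //; last first.
  by apply: measurable_fun_xsection; exact: affine_preimage_measurable.
apply: eq_integral => x _ /=.
rewrite -(lebesgue_measure_affine (r * x + u) s0 (measurable_xsection x mA)).
congr (_ * lebesgue_measure _)%E; apply/seteqP; split => y;
  rewrite /xsection /= !inE /= /affine /= mul1r mul0r !addr0;
  by rewrite (_ : r * x + s * y + u = s * y + (r * x + u)) //; ring.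
Qed.

Lemma area_shear1 {R : realType} (p q t : R) (A : set (mplane R)) :
  p != 0 -> measurable A ->
  (`|p|%:E * area (affine p q 0 1 t 0 @^-1` A))%E = area A.
Proof.
move=> p0 mA; have mpA := affine_preimage_measurable p q 0 1 t 0 mA.
rewrite !area_ysection // -ge0_integralZl //; last first.
  by apply: measurable_fun_ysection; exact: affine_preimage_measurable.
apply: eq_integral => y _ /=.
rewrite -(lebesgue_measure_affine (q * y + t) p0 (measurable_ysection y mA)).
congr (_ * lebesgue_measure _)%E; apply/seteqP; split => x;
  rewrite /ysection /= !inE /= /affine /= mul1r mul0r add0r !addr0;
  by rewrite addrA.
Qed.

Lemma area_affine {R : realType} (p q r s t u : R) (A : set (mplane R)) :
  p * s - q * r != 0 -> measurable A ->
  (`|p * s - q * r|%:E * area (affine p q r s t u @^-1` A))%E = area A.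
Proof.
move=> det0 mA.
wlog s0 : p q r s t u det0 / s != 0.
  have [E0|s0] := eqVneq s 0; last exact.
  rewrite E0 in det0 *.
  move=> /(_ p (p + q) r (0 + r) t u).
  have dE : p * (0 + r) - (p + q) * r = p * 0 - q * r by ring.
  have r0 : r != 0.
    by apply: contra_neq det0 => r0; rewrite r0; ring.
  rewrite dE add0r => /(_ det0 r0) <-; congr (_ * _)%E.
  have mB := affine_preimage_measurable p (p + q) r r t u mA.
  rewrite -[RHS](area_shear1 (-1) 0 (oner_neq0 R) mB) normr1 mul1e.
  congr (area _); apply/seteqP; split => z;
    rewrite /affine /=; set w := (X in A X); set w' := (X in _ -> A X);
    suff -> : w = w' by []; by congr pair; ring.
have q0 : (p * s - q * r) / s != 0 by rewrite mulf_neq0 ?invr_eq0.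
have mB := affine_preimage_measurable ((p * s - q * r) / s) (q / s) 0 1
  (t - q * u / s) 0 mA.
rewrite -[RHS](area_shear1 (q / s) (t - q * u / s) q0 mA).
rewrite -(area_shear2 r u s0 mB) muleA -EFinM -normrM divfK //.
congr (_ * area _)%E; apply/seteqP; split => z;
  rewrite /affine /=; set w := (X in A X); set w' := (X in _ -> A X);
  suff -> : w = w' by []; by congr pair; field.
Qed.

Lemma area_rect {R : realType} (a b c d : R) : a <= b -> c <= d ->
  area (rect a b c d) = ((b - a) * (d - c))%:E.
Proof.
move=> ab cd; rewrite [LHS]product_measure1E; [|exact: measurable_itv..].
have lE (x y : R) := lebesgue_measure_itv `]x, y].
by rewrite [X in (X * _)%E]lE [X in (_ * X)%E]lE /= !lte_fin; case: ifPn => [_|];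
  case: ifPn => [_|]; rewrite -?leNgt => *; rewrite -?EFinB -?EFinM ?mule0 ?mul0e //;
  congr EFin; nra.
Qed.

(** * Lifts of torus maps *)

Lemma int_valued_continuous_cst {R : realType} (h : plane R -> R) :
  continuous h -> (forall z, exists n : int, h z = n%:~R) ->
  forall z w, h z = h w.
Proof.
move=> ch hZ; suff le z w : h z <= h w.
  by move=> z w; apply/eqP; rewrite eq_le !le.
rewrite leNgt; apply/negP => lt.
pose g (t : R) := h (z + t *: (w - z)).
have g0 : g 0 = h z by rewrite /g scale0r addr0.
have g1 : g 1 = h w by rewrite /g scale1r addrC subrK.
have [a ha] := hZ z; have [b hb] := hZ w.
have ba : (b%:~R : R) + 1 <= a%:~R.
  by rewrite -[1](_ : 1%:~R = _) // -intrD ler_int lezD1 -(ltr_int R) -ha -hb.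
have cg : continuous g.
  move=> t; apply: continuous_comp; last exact: ch.
  by apply: cvgD; [exact: cvg_cst|exact: cvgZr_tmp].
have [||t _ gt] := @IVT R g 0 1 (b%:~R + 2^-1) ler01.
- exact: continuous_subspaceT.
- by rewrite g0 g1 ha hb ge_min le_max; apply/andP; split; lra.
have [n hn] := hZ (z + t *: (w - z)).
have := hn; rewrite -/(g t) gt => bn.
have b1 : (b%:~R : R) < n%:~R by lra.
have n1 : (n%:~R : R) < (b + 1)%:~R by rewrite intrD; lra.
by move: b1 n1; rewrite !ltr_int ltzD1 ltNge => /negP.
Qed.

Definition zvec {R : realType} (a b : int) : plane R := (a%:~R, b%:~R).

Lemma zvecD {R : realType} (a b c d : int) :
  zvec (a + c) (b + d) = zvec a b + zvec c d :> plane R.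
Proof. by rewrite /zvec !intrD. Qed.

Lemma torus_proj_eq {R : realType} (z w : plane R) :
  torus_proj z = torus_proj w <-> exists a b, z - w = zvec a b.
Proof.
split=> [/eqmodP /asboolP //|zw]; apply/eqmodP; exact/asboolP.
Qed.

Lemma plane_comb {R : realType} (a b : R) (u v : plane R) :
  a *: u + b *: v = (u.1 * a + v.1 * b, u.2 * a + v.2 * b).
Proof.
by case: u v => [u1 u2] [v1 v2] /=; rewrite !(mulrC _ a) !(mulrC _ b).
Qed.

Section lift.
Variables (R : realType) (f : torus R -> torus R).

Lemma lift_unique (F F' : plane R -> plane R) : lift_of f F -> lift_of f F' ->
  forall z w, F z - F' z = F w - F' w.
Proof.
move=> [cF pF] [cF' pF'].
have FF' z : exists a b, F z - F' z = zvec a b.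
  by apply/torus_proj_eq; rewrite pF pF'.
have cFF' : continuous (fun z => F z - F' z).
  by move=> z; exact: cvgB (cF z) (cF' z).
move=> z w; rewrite [LHS]surjective_pairing [RHS]surjective_pairing; congr pair.
- apply: (int_valued_continuous_cst (h := fun z => (F z - F' z).1)) => [x|x].
    by apply: (continuous_comp (f := fun z => F z - F' z)) (cFF' x) _; exact: cvg_fst.
  by have [a [b ->]] := FF' x; exists a.
- apply: (int_valued_continuous_cst (h := fun z => (F z - F' z).2)) => [x|x].
    by apply: (continuous_comp (f := fun z => F z - F' z)) (cFF' x) _; exact: cvg_snd.
  by have [a [b ->]] := FF' x; exists b.
Qed.

Lemma lift_periodic (F : plane R -> plane R) (a b : int) (z w : plane R) :
  lift_of f F -> F (z + zvec a b) - F z = F (w + zvec a b) - F w.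
Proof.
move=> lF; apply: (@lift_unique (fun z => F (z + zvec a b))) => //.
have [cF pF] := lF; split=> [x|x].
  by apply: continuous_comp; [apply: cvgD; [exact: cvg_id|exact: cvg_cst]|exact: cF].
rewrite pF; congr (f _); apply/torus_proj_eq; exists a, b.
by rewrite addrC addKr.
Qed.

Lemma lift_expansion (F : plane R -> plane R) (J : R) (z : plane R) :
  torus_C2 f -> (forall x, `|det2 (torus_D f x)| = J) -> lift_of f F ->
  exists p q r s, `|p * s - q * r| = J /\
    forall e, 0 < e -> exists2 d, 0 < d & forall h : plane R, `|h| < d ->
      `|F (z + h) - F z - (p * h.1 + q * h.2, r * h.1 + s * h.2)| <= e * `|h|.
Proof.
move=> [F' lF' [[dF' _] _]] detJ lF.
have [F0 [lF0 F0E]] : exists F0, lift_of f F0 /\ get [set F | lift_of f F] = F0.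
  by eexists; split; last reflexivity; apply: (@getPex _ [set F | lift_of f F]); exists F'.
have [x [xE [a [b zx]]]] :
    exists x, repr (torus_proj z) = x /\ exists a b, z - x = zvec a b.
  eexists; split; first reflexivity.
  by apply/torus_proj_eq; rewrite /torus_proj reprK.
have dF0 : differentiable F0 x.
  have -> : F0 = F' + cst (F0 0 - F' 0).
    apply/funext => y; rewrite /= -(lift_unique lF0 lF' y 0).
    by rewrite /GRing.add /= addrC subrK.
  by apply: differentiableD.
pose L := 'd F0 x.
have LE h : L h = ((L (1, 0)).1 * h.1 + (L (0, 1)).1 * h.2,
                   (L (1, 0)).2 * h.1 + (L (0, 1)).2 * h.2).
  have -> : L h = L (h.1 *: (1, 0) + h.2 *: (0, 1)).
    congr (L _); rewrite [LHS]surjective_pairing; congr pair;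
      by rewrite /= scaler0 ?addr0 ?add0r; exact/esym/mulr1.
  rewrite linearD !linearZ /=.
  exact: plane_comb.
exists (L (1, 0)).1, (L (0, 1)).1, (L (1, 0)).2, (L (0, 1)).2; split.
  by rewrite -(detJ (torus_proj z)) /torus_D F0E xE.
move=> e e0; have /eqaddoP/(_ e e0) := diff_locally dF0.
move=> /nbhs_ballP[d /= d0 dP]; exists d => // h hd.
rewrite -LE.
have -> : F (z + h) - F z = F0 (x + h) - F0 x.
  have E y : F y = F0 y + (F 0 - F0 0).
    by rewrite -(lift_unique lF lF0 y 0) addrC subrK.
  have zE : z = x + zvec a b by rewrite -zx addrC subrK.
  have := lift_periodic a b (x + h) x lF0.
  move: (zvec a b) zE => n zE; rewrite [x + h + n]addrAC -zE => hE.
  rewrite (E (z + h)) (E z) opprD addrACA subrr addr0 -(subrK (F0 (x + h)) (F0 (z + h))) hE.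
  by rewrite addrAC [F0 z - F0 x - _]addrAC subrr add0r addrC.
have : ball (0 : plane R) d h by rewrite -ball_normE /= sub0r normrN.
move=> /dP; rewrite /= !fctE /=.
by rewrite opprD addrA [h + x]addrC.
Qed.

Section proper.
Variables (F G : plane R -> plane R).
Hypotheses (lF : lift_of f F) (FK : cancel F G) (GK : cancel G F) (F0 : F 0 = 0).

Lemma lift_additive (a b : int) (z : plane R) :
  F (z + zvec a b) = F z + F (zvec a b).
Proof.
have := lift_periodic a b z 0 lF; rewrite F0 subr0 add0r => <-.
by rewrite [RHS]addrC subrK.
Qed.

Lemma lift_zvec (a b : int) : exists c d, F (zvec a b) = zvec c d.
Proof.
have [_ pF] := lF.
have : torus_proj (F (zvec a b)) = torus_proj (F 0).
  by rewrite !pF; congr (f _); apply/torus_proj_eq; exists a, b; rewrite subr0.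
by rewrite F0 => /torus_proj_eq[c [d]]; rewrite subr0; exists c, d.
Qed.

Lemma lift_zmul (u v p q : int) : F (zvec u v) = zvec p q ->
  forall a, F (zvec (a * u) (a * v)) = zvec (a * p) (a * q).
Proof.
move=> Fuv a; elim/int_rect: a => [|n IH|n IH]; first by rewrite !mul0r.
- have S (x : int) : n.+1%:Z * x = n%:Z * x + x.
    by rewrite -[X in _ + X]mul1r -mulrDl intS addrC.
  by rewrite !S zvecD lift_additive IH Fuv zvecD.
- have S (x : int) : - n%:Z * x = - n.+1%:Z * x + x.
    by rewrite intS; ring.
  move: IH; rewrite !S zvecD lift_additive Fuv zvecD.
  by move/addIr.
Qed.

Lemma lift_linear : exists p q r s : int, p * s - q * r != 0 /\
  forall a b, F (zvec a b) = zvec (a * p + b * r) (a * q + b * s).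
Proof.
have [p [q e1]] := lift_zvec 1 0; have [r [s e2]] := lift_zvec 0 1.
have FE a b : F (zvec a b) = zvec (a * p + b * r) (a * q + b * s).
  have := lift_zmul e1 a; have := lift_zmul e2 b.
  rewrite !mulr1 !mulr0 => Fb Fa.
  by rewrite zvecD -Fa -Fb -lift_additive -zvecD addr0 add0r.
exists p, q, r, s; split => //; apply/eqP => det0.
have F_eq0 a b : a * p + b * r = 0 -> a * q + b * s = 0 -> a = 0 /\ b = 0.
  move=> h1 h2; have := FE a b; rewrite h1 h2 => Fab.
  have /(can_inj FK) : F (zvec a b) = F 0 by rewrite F0 Fab.
  by move=> [/eqP + /eqP]; rewrite !intr_eq0 => /eqP -> /eqP ->.
have [||s0 q0] := F_eq0 s (- q).
- by rewrite -det0; ring.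
- by ring.
have [||r0 p0] := F_eq0 (- r) p.
- by ring.
- by rewrite -det0; ring.
have [||/eqP] := F_eq0 1 0 => //.
- by rewrite p0; ring.
- by move/eqP: q0; rewrite oppr_eq0 => /eqP ->; ring.
Qed.

Lemma lift_proper (rho : R) : exists rho', forall z, `|F z| <= rho -> `|z| <= rho'.
Proof.
have [p [q [r [s [D0 FE]]]]] := lift_linear.
have [M MP] : exists M, forall w, 0 <= w.1 <= 1 -> 0 <= w.2 <= 1 -> `|F w| <= M.
  have cQ : compact (F @` (`[0, 1] `*` `[0, 1])).
    apply: continuous_compact; last by apply: compact_setX; exact: segment_compact.
    by apply: continuous_subspaceT; have [] := lF.
  have [M [_ MP]] := compact_bounded cQ; exists (M + 1) => w w1 w2.
  by apply: (MP (M + 1)); [rewrite ltrDl|exists w => //; split; rewrite /= in_itv].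
pose K : R := `|p%:~R| + `|q%:~R| + `|r%:~R| + `|s%:~R|.
exists (1 + K * (rho + M)) => z zrho.
pose a := Num.floor z.1; pose b := Num.floor z.2; pose w := z - zvec a b.
have /andP[a1 a2] := real_floor_itv (num_real z.1).
have /andP[b1 b2] := real_floor_itv (num_real z.2).
rewrite -/a -/b !intrD in a1 a2 b1 b2.
have w1 : 0 <= w.1 <= 1 by rewrite /w /=; apply/andP; split; lra.
have w2 : 0 <= w.2 <= 1 by rewrite /w /=; apply/andP; split; lra.
have Fn : `|F (zvec a b)| <= rho + M.
  have -> : F (zvec a b) = F z - F w.
    by rewrite -[z](subrK (zvec a b)) lift_additive addrC addKr.
  by rewrite (le_trans (ler_normB _ _)) // lerD // MP.
move: Fn; rewrite FE prod_normE ge_max /zvec /= => /andP[].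
set c := _ * p + _; set d := _ * q + _ => cM dM.
pose D := p * s - q * r.
have D1 : 1 <= `|D%:~R| :> R.
  by rewrite -intr_norm -[1](_ : 1%:~R = _) // ler_int; rewrite -gtz0_ge1 normr_gt0.
have bound (x : int) (u v : R) : x%:~R * D%:~R = c%:~R * u - d%:~R * v ->
    `|u| + `|v| <= K -> `|x%:~R| <= K * (rho + M) :> R.
  move=> xD uvK; have : `|x%:~R| <= `|x%:~R * D%:~R| :> R.
    by rewrite normrM ler_peMr.
  move/le_trans; apply; rewrite xD (le_trans (ler_normB _ _)) // !normrM.
  have := normr_ge0 (c%:~R : R); have := normr_ge0 (d%:~R : R).
  have := normr_ge0 u; have := normr_ge0 v; nra.
have aK : `|a%:~R| <= K * (rho + M) :> R.
  apply: (bound a s%:~R r%:~R).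
    by rewrite -!intrM -intrB; congr (_%:~R); rewrite /c /d /D; ring.
  by rewrite /K; have := normr_ge0 (p%:~R : R); have := normr_ge0 (q%:~R : R); lra.
have bK : `|b%:~R| <= K * (rho + M) :> R.
  apply: (bound b (- q%:~R) (- p%:~R)).
    by rewrite !mulrN opprK -!intrM addrC -intrB; congr (_%:~R); rewrite /c /d /D; ring.
  by rewrite /K !normrN; have := normr_ge0 (r%:~R : R); have := normr_ge0 (s%:~R : R); lra.
rewrite prod_normE ge_max; apply/andP; split.
- rewrite -(subrK a%:~R z.1) (le_trans (ler_normD _ _)) // lerD //.
  by rewrite ler_norml; lra.
- rewrite -(subrK b%:~R z.2) (le_trans (ler_normD _ _)) // lerD //.
  by rewrite ler_norml; lra.
Qed.

Lemma lift_inv_continuous : continuous G.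
Proof.
have [cF _] := lF.
apply/continuous_closedP => C cC y Cy.
have [r rP] := lift_proper (`|y| + 1).
pose K : set (plane R) := `[- r, r] `*` `[- r, r].
have cK : compact K by apply: compact_setX; exact: segment_compact.
have cT : closed (F @` (K `&` C)).
  apply: compact_closed; first exact: norm_hausdorff.
  apply: continuous_compact; last exact: compact_closedI.
  exact: continuous_subspaceT.
suff : (F @` (K `&` C)) y by move=> [c [_ Cc] <-]; rewrite /preimage /= FK.
apply: cT => N nN.
have [] := Cy (N `&` ball y 1); first by apply: filterI => //; exact: nbhsx_ballx.
move=> y' [/= Cy' [Ny' yy']]; exists y'; split => //; exists (G y') => //.
split=> //; have : `|G y'| <= r.
  apply: rP; rewrite GK -(subrK y y') (le_trans (ler_normD _ _)) //.
  rewrite addrC lerD2l distrC; move: yy'; rewrite -ball_normE /= => /ltW.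
  by [].
rewrite /K /= !in_itv /= prod_normE ge_max !ler_norml.
by move=> /andP[-> ->].
Qed.

End proper.
End lift.

(** * Area of images *)

Lemma quartering {R : realType} (P : R -> R -> R -> R -> Prop) (h0 k0 : R) :
  0 < h0 -> 0 < k0 ->
  (forall x y h k, 0 < h -> 0 < k -> P x y h k -> P (x + h) y h k ->
    P x (y + k) h k -> P (x + h) (y + k) h k -> P x y (h + h) (k + k)) ->
  (forall cx cy, exists2 d, 0 < d & forall t x y, 0 < t -> t < d ->
    x <= cx <= x + t * h0 -> y <= cy <= y + t * k0 ->
    P x y (t * h0) (t * k0)) ->
  forall x y, P x y h0 k0.
Proof.
move=> h00 k00 P4 Ploc x0 y0; apply: contrapT => nP0.
pose t (n : nat) : R := 2^-1 ^+ n.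
have t0 n : 0 < t n by rewrite exprn_gt0 // invr_gt0.
have tS n : t n = t n.+1 + t n.+1 by rewrite /t exprS; lra.
have step (np : nat * (R * R)) : exists p' : R * R,
    [/\ ~ P np.2.1 np.2.2 (t np.1 * h0) (t np.1 * k0) ->
        ~ P p'.1 p'.2 (t np.1.+1 * h0) (t np.1.+1 * k0),
        np.2.1 <= p'.1 <= np.2.1 + t np.1.+1 * h0 &
        np.2.2 <= p'.2 <= np.2.2 + t np.1.+1 * k0].
  case: np => n [x y] /=.
  have hn0 : 0 < t n.+1 * h0 by rewrite mulr_gt0.
  have kn0 : 0 < t n.+1 * k0 by rewrite mulr_gt0.
  have := P4 x y _ _ hn0 kn0; rewrite -!mulrDl -tS => {}P4.
  have [p1|] := pselect (P x y (t n.+1 * h0) (t n.+1 * k0)); last first.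
    by move=> np; exists (x, y); split => //=; lra.
  have [p2|] := pselect (P (x + t n.+1 * h0) y (t n.+1 * h0) (t n.+1 * k0)); last first.
    by move=> np; exists (x + t n.+1 * h0, y); split => //=; lra.
  have [p3|] := pselect (P x (y + t n.+1 * k0) (t n.+1 * h0) (t n.+1 * k0)); last first.
    by move=> np; exists (x, y + t n.+1 * k0); split => //=; lra.
  exists (x + t n.+1 * h0, y + t n.+1 * k0); split => /=; [|lra|lra].
  by move=> nP p4; apply: nP; exact: P4.
have [s sP] := choice step.
pose fix u n := if n is m.+1 then s (m, u m) else (x0, y0).
have uP n : ~ P (u n).1 (u n).2 (t n * h0) (t n * k0).
  elim: n => [|n IH]; first by rewrite /t expr0 !mul1r.
  by have [+ _ _] := sP (n, u n); exact.
have u1 n : (u n).1 <= (u n.+1).1 /\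
    (u n.+1).1 + t n.+1 * h0 <= (u n).1 + t n * h0.
  by have [_ /= /andP[? ?] _] := sP (n, u n); rewrite [t n]tS; split; lra.
have u2 n : (u n).2 <= (u n.+1).2 /\
    (u n.+1).2 + t n.+1 * k0 <= (u n).2 + t n * k0.
  by have [_ _ /= /andP[? ?]] := sP (n, u n); rewrite [t n]tS; split; lra.
have nested (a : R ^nat) (l : R) : 0 < l ->
    (forall n, a n <= a n.+1 /\ a n.+1 + t n.+1 * l <= a n + t n * l) ->
    forall n, a n <= sup (range a) <= a n + t n * l.
  move=> l0 aP n.
  have inc : {homo a : m n / (m <= n)%N >-> m <= n}.
    by apply: homo_leq => // [y x z|i]; [exact: le_trans|have [] := aP i].
  have dec : {homo (fun n => a n + t n * l) : m n / (m <= n)%N >-> n <= m}.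
    apply: (@homo_leq _ _ (fun x y => y <= x)) => // [y x z|i].
      by move=> h1 h2; exact: le_trans h2 h1.
    by have [] := aP i.
  have am m : a m <= a n + t n * l.
    rewrite (le_trans (inc _ _ (leq_maxl m n))) //.
    rewrite (le_trans _ (dec _ _ (leq_maxr m n))) // lerDl.
    by rewrite mulr_ge0 // ltW.
  apply/andP; split.
    apply: ub_le_sup; last by exists n.
    by exists (a n + t n * l) => _ [m _ <-].
  by apply: ge_sup; [exists (a 0%N); exists 0%N|move=> _ [m _ <-]].
have [d d0 dP] := Ploc (sup (range (fun n => (u n).1)))
  (sup (range (fun n => (u n).2))).
pose n := Num.bound d^-1.
apply: (uP n); apply: dP => //.
- rewrite /t exprVn invf_plt ?posrE ?exprn_gt0 //.
  exact: upper_nthrootP.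
- exact: (nested (fun n => (u n).1)).
- exact: (nested (fun n => (u n).2)).
Qed.

Lemma plane_normP {R : realType} (z : plane R) (e : R) :
  `|z| <= e <-> `|z.1| <= e /\ `|z.2| <= e.
Proof. by rewrite prod_normE ge_max; split => /andP. Qed.

Lemma area_setU4 {R : realType} (A B C D : set (mplane R)) :
  measurable A -> measurable B -> measurable C -> measurable D ->
  A `&` B = set0 -> C `&` D = set0 -> (A `|` B) `&` (C `|` D) = set0 ->
  area ((A `|` B) `|` (C `|` D)) = (area A + area B + (area C + area D))%E.
Proof.
move=> mA mB mC mD AB CD ABCD.
rewrite measureU //; [|exact: measurableU|exact: measurableU].
by congr (_ + _)%E; rewrite measureU.
Qed.

Lemma window_le {R : realType} (x h c b w : R) : 0 <= b ->
  x - c + b < w -> w <= x + h - c - b -> x <= c -> c <= x + h -> `|w| <= h.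
Proof. by move=> ? ? ? ? ?; rewrite ler_norml; lra. Qed.

Lemma window_shrink {R : realType} (x h c b w g : R) : `|w - (g - c)| <= b ->
  x - c + b < w -> w <= x + h - c - b -> x < g /\ g <= x + h.
Proof. by rewrite ler_norml => /andP[? ?] ? ?; split; lra. Qed.

Lemma window_expand {R : realType} (x h c b w g : R) : `|w - (g - c)| <= b ->
  x < g -> g <= x + h -> x - c - b < w /\ w <= x + h - c + b.
Proof. by rewrite ler_norml => /andP[? ?] ? ?; split; lra. Qed.

Lemma window_expand_le {R : realType} (x h c b : R) : 0 <= b -> 0 <= h ->
  x - c - b <= x + h - c + b.
Proof. by move=> ? ?; lra. Qed.

Lemma le_double {R : realType} (eta B v w d : R) : 0 <= v -> eta <= 2^-1 ->
  w <= B -> v <= w + d -> d <= eta * v -> v <= 2 * B.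
Proof. by move=> ? ? ? ? ?; nra. Qed.

Lemma window_length {R : realType} (x h c b e : R) : b <= e * h ->
  (1 - 2 * e) * h <= x + h - c - b - (x - c + b) /\
  x + h - c + b - (x - c - b) <= (1 + 2 * e) * h.
Proof. by move=> ?; split; lra. Qed.

Section area_scaling.
Variables (R : realType) (F G : plane R -> plane R) (J : R).
Hypotheses (FK : cancel F G) (GK : cancel G F) (J0 : 0 < J).
Hypothesis cG : continuous G.
Hypothesis dF : forall z, exists p q r s, `|p * s - q * r| = J /\
  forall e, 0 < e -> exists2 d, 0 < d & forall h : plane R, `|h| < d ->
    `|F (z + h) - F z - (p * h.1 + q * h.2, r * h.1 + s * h.2)| <= e * `|h|.

(* Near [c] the map [F] is compared with the affine chart [w], the inverse of
   the first order expansion of [F] at [c]. *)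
Lemma inverse_chart (c : plane R) : exists w : plane R -> plane R,
  [/\ forall A : set (mplane R), measurable A ->
        measurable (w @^-1` A : set (mplane R)),
      forall A : set (mplane R), measurable A -> area (w @^-1` A) = (J%:E * area A)%E,
      exists2 N, 0 < N & forall y, `|y - F c| <= N * `|w y| &
      forall e, 0 < e -> exists2 d, 0 < d & forall h : plane R, `|h| < d ->
        `|w (F (c + h)) - h| <= e * `|h|].
Proof.
have [p [q [r [s [DJ Fc]]]]] := dF c.
pose D := p * s - q * r.
have D0 : D != 0 by rewrite -normr_gt0 DJ.
pose w := affine (s / D) (- q / D) (- r / D) (p / D)
  (- ((s / D) * (F c).1 + (- q / D) * (F c).2))
  (- ((- r / D) * (F c).1 + (p / D) * (F c).2)).
have detw : (s / D) * (p / D) - (- q / D) * (- r / D) = D^-1.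
  rewrite (_ : _ - _ = D / (D * D)); last by rewrite /D; field.
  by field.
exists w; split.
- by move=> A; exact: affine_preimage_measurable.
- move=> A mA.
  rewrite -(area_affine (p := s / D) (q := - q / D) (r := - r / D) (s := p / D)
    (- ((s / D) * (F c).1 + (- q / D) * (F c).2))
    (- ((- r / D) * (F c).1 + (p / D) * (F c).2)) _ mA) detw ?invr_eq0 //.
  by rewrite muleA -EFinM normfV DJ divff ?mul1e // gt_eqF.
- exists (`|p| + `|q| + `|r| + `|s| + 1) => [|y].
    by rewrite ltr_wpDl ?addr_ge0.
  have y1 : (y - F c).1 = p * (w y).1 + q * (w y).2.
    by rewrite /w /affine /=; move: D0; rewrite /D => D0; field.
  have y2 : (y - F c).2 = r * (w y).1 + s * (w y).2.
    by rewrite /w /affine /=; move: D0; rewrite /D => D0; field.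
  have [w1 w2] : `|(w y).1| <= `|w y| /\ `|(w y).2| <= `|w y| by exact/plane_normP.
  have W0 := normr_ge0 (w y).
  apply/plane_normP; rewrite y1 y2; split; rewrite (le_trans (ler_normD _ _)) // !normrM.
  + by have := normr_ge0 p; have := normr_ge0 q; have := normr_ge0 r;
      have := normr_ge0 s; nra.
  + by have := normr_ge0 p; have := normr_ge0 q; have := normr_ge0 r;
      have := normr_ge0 s; nra.
- move=> e e0; pose K := (`|p| + `|q| + `|r| + `|s| + 1) / J.
  have K0 : 0 < K by rewrite divr_gt0 // ltr_wpDl ?addr_ge0.
  have [d d0 dP] := Fc (e / K) (divr_gt0 e0 K0); exists d => // h hd.
  have := dP h hd; set v := F (c + h) - F c - _ => vh.
  have w1 : (w (F (c + h)) - h).1 = (s / D) * v.1 + (- q / D) * v.2.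
    by rewrite /w /affine /v /=; move: D0; rewrite /D => D0; field.
  have w2 : (w (F (c + h)) - h).2 = (- r / D) * v.1 + (p / D) * v.2.
    by rewrite /w /affine /v /=; move: D0; rewrite /D => D0; field.
  have [v1 v2] : `|v.1| <= e / K * `|h| /\ `|v.2| <= e / K * `|h| by exact/plane_normP.
  have eK : e * `|h| = K * (e / K * `|h|) by field; rewrite gt_eqF.
  move: (e / K * `|h|) v1 v2 eK => B v1 v2 ->.
  have B0 : 0 <= B by rewrite (le_trans _ v1).
  have V := normr_ge0 v.1; have V' := normr_ge0 v.2.
  have KE : K * B = (`|p| + `|q| + `|r| + `|s| + 1) * B / J by rewrite /K; ring.
  apply/plane_normP; rewrite w1 w2 KE; split; rewrite (le_trans (ler_normD _ _)) //;
    rewrite !normrM normfV normrN -/D DJ.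
  + rewrite ![_ / J * _]mulrAC -mulrDl ler_pM2r ?invr_gt0 //.
    by have := normr_ge0 p; have := normr_ge0 q; have := normr_ge0 r;
      have := normr_ge0 s; nra.
  + rewrite ![_ / J * _]mulrAC -mulrDl ler_pM2r ?invr_gt0 //.
    by have := normr_ge0 p; have := normr_ge0 q; have := normr_ge0 r;
      have := normr_ge0 s; nra.
Qed.

Definition image_area (x y h k : R) : \bar R :=
  area (G @^-1` rect x (x + h) y (y + k)).

Lemma image_rect_measurable (A : set (mplane R)) :
  measurable A -> measurable (G @^-1` A : set (mplane R)).
Proof.
by move=> mA; rewrite -[X in measurable X]setTI; exact: continuous_measurable_plane.
Qed.

Lemma rect_measurable (a b c d : R) : measurable (rect a b c d).
Proof. by apply: measurableX; exact: measurable_itv. Qed.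

Lemma image_area_quarters (x y h k : R) : 0 < h -> 0 < k ->
  image_area x y (h + h) (k + k) =
  (image_area x y h k + image_area (x + h) y h k +
  (image_area x (y + k) h k + image_area (x + h) (y + k) h k))%E.
Proof.
move=> h0 k0; rewrite /image_area.
have mr a b c d := image_rect_measurable (rect_measurable a b c d).
have disj a b c d a' b' c' d' : b <= a' \/ d <= c' ->
    G @^-1` rect a b c d `&` G @^-1` rect a' b' c' d' = set0.
  move=> sep; apply/seteqP; split => // z [] /rectP[? ? ? ?] /rectP[? ? ? ?].
  by case: sep => ?; lra.
rewrite -area_setU4 //; [|by apply: disj; left|by apply: disj; left|]; last first.
  by rewrite setIUl !setIUr !disj ?setU0 //; right.
congr (area _); apply/seteqP; split => z /=; rewrite !rectP.
- move=> [? ? ? ?]; have [?|?] := leP (G z).1 (x + h);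
      have [?|?] := leP (G z).2 (y + k).
  + by left; left; split; lra.
  + by right; left; split; lra.
  + by left; right; split; lra.
  + by right; right; split; lra.
- by move=> [] [] [? ? ? ?]; split; lra.
Qed.

Lemma image_area_local (cx cy h0 k0 e : R) :
  0 < h0 -> 0 < k0 -> 0 < e -> e < 4^-1 ->
  exists2 d, 0 < d & forall t x y, 0 < t -> t < d ->
    x <= cx <= x + t * h0 -> y <= cy <= y + t * k0 ->
    ((J * (1 - 2 * e) ^+ 2 * (t * h0 * (t * k0)))%:E <=
      image_area x y (t * h0) (t * k0))%E /\
    (image_area x y (t * h0) (t * k0) <=
      (J * (1 + 2 * e) ^+ 2 * (t * h0 * (t * k0)))%:E)%E.
Proof.
move=> h00 k00 e0 e4.
have e2 : 0 <= 1 - 2 * e by lra.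
have [w [mw aw [N N0 wN] wF]] := inverse_chart (cx, cy).
pose m := Num.min h0 k0; pose M := Num.max h0 k0.
have m0 : 0 < m by rewrite /m lt_min h00.
have [mh mk] : m <= h0 /\ m <= k0 by rewrite /m !ge_min !lexx orbT.
have [hM kM] : h0 <= M /\ k0 <= M by rewrite /M !le_max !lexx orbT.
have M0 : 0 < M by exact: lt_le_trans hM.
have mM : m <= M by exact: le_trans hM.
pose eta := e * m / (2 * M).
have eta0 : 0 < eta by rewrite /eta divr_gt0 ?mulr_gt0.
have etaM : 2 * eta * M = e * m by rewrite /eta; field; rewrite gt_eqF.
have eta2 : eta <= 2^-1 by rewrite ler_pdivrMr ?mulr_gt0 //; nra.
have [d1 d10 wd1] := wF eta eta0.
have [d2 d20 Gd2] : exists2 d2, 0 < d2 & forall y, `|y - F (cx, cy)| < d2 ->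
    `|G y - (cx, cy)| < d1.
  have /nbhs_ballP[d2 /= d20 d2P] :
      nbhs (F (cx, cy)) (G @^-1` ball (G (F (cx, cy))) d1).
    by apply: cG; exact: nbhsx_ballx.
  exists d2 => // y yd; have : ball (F (cx, cy)) d2 y by rewrite -ball_normE /= distrC.
  by move=> /d2P; rewrite /= FK -ball_normE /= distrC.
exists (Num.min (d1 / M) (d2 / (N * M))).
  by rewrite lt_min !divr_gt0 ?mulr_gt0.
move=> t x y t0; rewrite lt_min => /andP[].
rewrite !ltr_pdivlMr ?mulr_gt0 // => tM tNM /andP[xc cx'] /andP[yc cy'].
have th0 : 0 < t * h0 by rewrite mulr_gt0.
have tk0 : 0 < t * k0 by rewrite mulr_gt0.
have thM : t * h0 <= t * M by rewrite ler_pM2l.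
have tkM : t * k0 <= t * M by rewrite ler_pM2l.
have tM0 : 0 < t * M by rewrite mulr_gt0.
have tmh : t * m <= t * h0 by rewrite ler_pM2l.
have tmk : t * m <= t * k0 by rewrite ler_pM2l.
have tm0 : 0 < t * m by rewrite mulr_gt0.
pose b := e * (t * m).
have b0 : 0 < b by rewrite mulr_gt0.
have bh : b <= e * (t * h0) by rewrite ler_pM2l.
have bk : b <= e * (t * k0) by rewrite ler_pM2l.
have etab : eta * (2 * (t * M)) = b by rewrite /b (mulrCA e t m) -etaM; ring.
have mQ := image_rect_measurable
  (rect_measurable x (x + t * h0) y (y + t * k0)).
split.
- pose Q' := rect (x - cx + b) (x + t * h0 - cx - b)
    (y - cy + b) (y + t * k0 - cy - b).
  have mQ' : measurable Q' by exact: rect_measurable.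
  have wQ : w @^-1` Q' `<=` G @^-1` rect x (x + t * h0) y (y + t * k0).
    move=> z /rectP[q1 q2 q3 q4].
    have wz : `|w z| <= t * M.
      apply/plane_normP; split.
        exact: le_trans (window_le (ltW b0) q1 q2 xc cx') thM.
      exact: le_trans (window_le (ltW b0) q3 q4 yc cy') tkM.
    have zd : `|G z - (cx, cy)| < d1.
      apply: Gd2; rewrite (le_lt_trans (wN z)) // (le_lt_trans _ tNM) //.
      by rewrite mulrCA ler_pM2l.
    have := wd1 _ zd; rewrite [(cx, cy) + _]addrC subrK GK.
    set v := G z - (cx, cy) => wv.
    have vw : `|v| <= 2 * (t * M).
      apply: (le_double (normr_ge0 v) eta2 wz _ wv).
      by rewrite -[X in `|X| <= _](subKr (w z)) (le_trans (ler_normB _ _)).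
    have {}wv : `|w z - v| <= b by rewrite (le_trans wv) // -etab ler_pM2l.
    move: wv => /plane_normP[wv1 wv2].
    have [g1 g2] := window_shrink wv1 q1 q2.
    by have [g3 g4] := window_shrink wv2 q3 q4; apply/rectP.
  apply: le_trans (le_measure area _ _ wQ); rewrite ?inE //; last exact: mw.
  have [H _] := window_length x cx bh; have [K _] := window_length y cy bk.
  have H0 : 0 <= (1 - 2 * e) * (t * h0) by rewrite mulr_ge0 // ltW.
  have K0 : 0 <= (1 - 2 * e) * (t * k0) by rewrite mulr_ge0 // ltW.
  have Hle := le_trans H0 H; have Kle := le_trans K0 K.
  rewrite subr_ge0 in Hle; rewrite subr_ge0 in Kle.
  rewrite [leRHS](aw _ mQ') area_rect //.
  rewrite -EFinM lee_fin -mulrA ler_pM2l // expr2.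
  by rewrite mulrACA ler_pM.
- pose Q' := rect (x - cx - b) (x + t * h0 - cx + b)
    (y - cy - b) (y + t * k0 - cy + b).
  have mQ' : measurable Q' by exact: rect_measurable.
  have wQ : G @^-1` rect x (x + t * h0) y (y + t * k0) `<=` w @^-1` Q'.
    move=> z /rectP[q1 q2 q3 q4].
    pose v := G z - (cx, cy).
    have vM : `|v| <= t * M.
      apply/plane_normP; rewrite /v /=; split.
        apply: le_trans (@window_le _ x _ cx 0 _ _ _ _ xc cx') thM;
          by rewrite ?addr0 ?subr0 ?ltrD2r ?lerD2r.
      apply: le_trans (@window_le _ y _ cy 0 _ _ _ _ yc cy') tkM;
        by rewrite ?addr0 ?subr0 ?ltrD2r ?lerD2r.
    have := wd1 v (le_lt_trans vM tM).
    rewrite {1}/v [(cx, cy) + _]addrC subrK GK => wv.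
    have {}wv : `|w z - v| <= b.
      by rewrite (le_trans wv) // -etab ler_pM2l // (le_trans vM) // ler_peMl ?ltW // ltr1n.
    move: wv => /plane_normP[wv1 wv2].
    have [g1 g2] := window_expand wv1 q1 q2.
    by have [g3 g4] := window_expand wv2 q3 q4; apply/rectP.
  apply: le_trans (le_measure area _ _ wQ) _; rewrite ?inE //; first exact: mw.
  have [_ H] := window_length x cx bh; have [_ K] := window_length y cy bk.
  have Hle : x - cx - b <= x + t * h0 - cx + b by apply: window_expand_le; exact: ltW.
  have Kle : y - cy - b <= y + t * k0 - cy + b by apply: window_expand_le; exact: ltW.
  rewrite [leLHS](aw _ mQ') area_rect //.
  rewrite -EFinM lee_fin -mulrA ler_pM2l // expr2.
  by rewrite mulrACA ler_pM ?subr_ge0.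
Qed.

Lemma image_area_rect (x y h k : R) : 0 < h -> 0 < k ->
  image_area x y h k = (J * (h * k))%:E.
Proof.
move=> h0 k0.
have up C : J < C -> (image_area x y h k <= (C * (h * k))%:E)%E.
  move=> JC; pose P a b c d := (image_area a b c d <= (C * (c * d))%:E)%E.
  apply: (@quartering _ P h k h0 k0); rewrite {}/P.
    move=> u v a b a0 b0 P1 P2 P3 P4; rewrite image_area_quarters //.
    apply: (le_trans (leeD (leeD P1 P2) (leeD P3 P4))).
    by rewrite -!EFinD lee_fin; lra.
  move=> cx cy; pose e := Num.min 5^-1 ((C - J) / (5 * J)).
  have e0 : 0 < e by rewrite /e lt_min invr_gt0 ltr0n divr_gt0 ?subr_gt0 // mulr_gt0.
  have e5 : e <= 5^-1 by rewrite /e ge_min lexx.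
  have eC : e * (5 * J) <= C - J.
    by rewrite -ler_pdivlMr ?mulr_gt0 // /e ge_min lexx orbT.
  have e4 : e < 4^-1 by lra.
  have [d d0 dP] := image_area_local cx cy h0 k0 e0 e4; exists d => // t u v t0 td uc vc.
  have [_] := dP t u v t0 td uc vc; move/le_trans; apply.
  rewrite lee_fin ler_pM2r ?mulr_gt0 //.
  have : (1 + 2 * e) ^+ 2 <= 1 + 5 * e by rewrite expr2; nra.
  by move=> /(ler_wpM2l (ltW J0)); lra.
have lo C : 0 < C -> C < J -> ((C * (h * k))%:E <= image_area x y h k)%E.
  move=> C0 CJ; pose P a b c d := ((C * (c * d))%:E <= image_area a b c d)%E.
  apply: (@quartering _ P h k h0 k0); rewrite {}/P.
    move=> u v a b a0 b0 P1 P2 P3 P4; rewrite image_area_quarters //.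
    apply: (le_trans _ (leeD (leeD P1 P2) (leeD P3 P4))).
    by rewrite -!EFinD lee_fin; lra.
  move=> cx cy; pose e := Num.min 5^-1 ((J - C) / (5 * J)).
  have e0 : 0 < e by rewrite /e lt_min invr_gt0 ltr0n divr_gt0 ?subr_gt0 // mulr_gt0.
  have e5 : e <= 5^-1 by rewrite /e ge_min lexx.
  have eC : e * (5 * J) <= J - C.
    by rewrite -ler_pdivlMr ?mulr_gt0 // /e ge_min lexx orbT.
  have e4 : e < 4^-1 by lra.
  have [d d0 dP] := image_area_local cx cy h0 k0 e0 e4; exists d => // t u v t0 td uc vc.
  have [+ _] := dP t u v t0 td uc vc; apply: le_trans.
  rewrite lee_fin ler_pM2r ?mulr_gt0 //.
  have : 1 - 5 * e <= (1 - 2 * e) ^+ 2 by rewrite expr2; nra.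
  by move=> /(ler_wpM2l (ltW J0)); lra.
have hk0 : 0 < h * k by rewrite mulr_gt0.
have J1 : J < J + 1 by rewrite ltrDl.
have fin : image_area x y h k \is a fin_num.
  by rewrite ge0_fin_numE ?measure_ge0 // (le_lt_trans (up _ J1)) // ltry.
rewrite -(fineK fin) in up lo *; move: (fine _) up lo => v up lo.
have vE := divfK (lt0r_neq0 hk0) v.
congr EFin; rewrite -vE; congr (_ * _).
apply/eqP; rewrite eq_le; apply/andP; split; rewrite leNgt; apply/negP => lt.
- have /up : J < (J + v / (h * k)) / 2 by lra.
  by rewrite lee_fin -[v in v <= _]vE ler_pM2r //; lra.
- have v0 : 0 <= v / (h * k).
    have J2 : 0 < J / 2 by rewrite divr_gt0.
    have J2J : J / 2 < J by lra.
    have := lo _ J2 J2J; rewrite lee_fin -[v in _ <= v]vE ler_pM2r //; lra.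
  have C0 : 0 < (J + v / (h * k)) / 2 by lra.
  have CJ : (J + v / (h * k)) / 2 < J by lra.
  have := lo _ C0 CJ; rewrite lee_fin -[v in _ <= v]vE ler_pM2r //; lra.
Qed.

Lemma area_preimage (A : set (mplane R)) : measurable A ->
  area (G @^-1` A) = (J%:E * area A)%E.
Proof.
move=> mA; have mG := continuous_measurable_plane cG.
pose m1 : {measure set (mplane R) -> \bar R} :=
  pushforward area (G : mplane R -> mplane R).
pose m2 : {measure set (mplane R) -> \bar R} := mscale (NngNum (ltW J0)) area.
have E n : (m1 mG) (ratrect n) = m2 (ratrect n) /\ ((m1 mG) (ratrect n) < +oo)%E.
  change (area (G @^-1` ratrect n) = J%:E * area (ratrect n) /\
    area (G @^-1` ratrect n) < +oo)%E.
  rewrite /ratrect; case: unpickle => [[[[a b] c] d]|]; last first.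
    by rewrite preimage_set0 !measure0 mule0.
  have [ba|ab] := leP (ratr b : R) (ratr a).
    rewrite (_ : rect _ _ _ _ = set0) ?preimage_set0 ?measure0 ?mule0 //.
    by apply/seteqP; split => // z /rectP[]; lra.
  have [dc|cd] := leP (ratr d : R) (ratr c).
    rewrite (_ : rect _ _ _ _ = set0) ?preimage_set0 ?measure0 ?mule0 //.
    by apply/seteqP; split => // z /rectP[]; lra.
  rewrite area_rect ?ltW // -EFinM.
  have := @image_area_rect (ratr a) (ratr c) (ratr b - ratr a) (ratr d - ratr c).
  have addE (u v : R) : u + (v - u) = v by rewrite addrC subrK.
  rewrite !subr_gt0 /image_area !addE => ->//.
  by rewrite ltry.
apply: (measure_unique (range (@ratrect R)) (@ratrect R) _ _ _ _ (m1 mG) m2) => //.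
- exact: measurable_planeE.
- exact: ratrect_setI.
- apply/seteqP; split => // z _.
  by have [n nz _] := ratrect_basis z (@ltr01 R); exists n.
- by move=> _ [n _ <-]; have [] := E n.
- by move=> n; have [] := E n.
Qed.

End area_scaling.

(** * Transport of disintegrations *)

Lemma Radon_Nikodym_self {R : realType} (mu : probability (mplane R) R) :
  ae_eq mu setT (Radon_Nikodym (charge_of_finite_measure mu) mu) (cst 1%E).
Proof.
have mumu : mu `<< mu by [].
apply: integral_ae_eq => //; first exact: Radon_Nikodym_integrable.
move=> E _ mE; rewrite -Radon_Nikodym_integral //.
by rewrite integral_cst // mul1e.
Qed.

Lemma density_ae_eq1 {R : realType} (mu : probability (mplane R) R)
    (lam : set (mplane R) -> \bar R) :
  (forall A, measurable A -> mu A = lam A) ->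
  density_ae mu lam (fun r => r = 1%E).
Proof.
move=> mulam; exists mu; split => //.
by have := Radon_Nikodym_self mu; apply: filterS => x; exact.
Qed.

(* Existence of the probability rules out area [0] and [+oo]. *)
Lemma normalized_proper {R : realType} (U : set (mplane R))
    (P : probability (mplane R) R) :
  (forall A, measurable A -> P A = normalized area U A) ->
  exists2 u : R, 0 < u & area U = u%:E.
Proof.
move=> PE; have := PE _ measurableT.
rewrite probability_setT /normalized setTI.
have : (0 <= area U)%E by exact: measure_ge0.
case: (area U) => [u|_|//] /=.
  rewrite lee_fin inver => u0; have [->|un0] := eqVneq u 0.
    by rewrite mul0e => /eqP; rewrite onee_eq0.
  by exists u => //; rewrite lt0r un0.
by rewrite invey mule0 => /eqP; rewrite onee_eq0.
Qed.

Lemma disintegrates_image {R : realType}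
    (f : {mfun mplane R >-> mplane R}) (g : mplane R -> mplane R) (K : R)
    (U : set (mplane R)) (W : mplane R -> set (mplane R))
    (mu : mplane R -> probability (mplane R) R) :
  cancel f g -> cancel g f -> measurable_fun setT g ->
  0 < K -> (forall A, measurable A -> area (f @^-1` A) = (K%:E * area A)%E) ->
  disintegrates U W mu ->
  disintegrates (f @` U) (fun x => f @` W (g x))
    (fun x => distribution (mu (g x)) f).
Proof.
move=> fK gK mg K0 fE [mU [P [PE mmu aemu Pmu]]].
have mf : measurable_fun setT f by [].
have pre (h : mplane R -> mplane R) (mh : measurable_fun setT h) (A : set (mplane R)) :
    measurable A -> measurable (h @^-1` A).
  by move=> mA; rewrite -[X in measurable X]setTI; exact: mh.
have imE A : f @` A = g @^-1` A.
  apply/seteqP; split => [_ [x Ax <-]|x Ax]; first by rewrite /preimage /= fK.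
  by exists (g x).
have preE A : f @^-1` (g @^-1` A) = A.
  by apply/seteqP; split => x; rewrite /preimage /= fK.
have mU' : measurable (f @` U) by rewrite imE; exact: pre.
split => //; exists (distribution P f); split.
- move=> A mA; have [u u0 uE] := normalized_proper PE.
  rewrite [LHS](PE (f @^-1` A)); last exact: pre.
  have fAU : f @^-1` A `&` U = f @^-1` (A `&` f @` U).
    by rewrite imE preimage_setI preE.
  have UE := fE _ mU'; rewrite imE preE uE -imE in UE.
  rewrite /normalized fAU fE; last exact: measurableI.
  have [v v0 vE] : exists2 v : R, v != 0 & area (f @` U) = v%:E.
    have : (area (f @` U) \is a fin_num).
      have : (0 <= area (f @` U))%E by exact: measure_ge0.
      by move: UE; case: (area (f @` U)) => //=; rewrite mulry gtr0_sg // mul1e.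
    move=> afin; have vE := fineK afin; exists (fine (area (f @` U))) => //.
    apply/eqP => v0; move: UE; rewrite -vE v0 mule0 => -[/eqP].
    by rewrite gt_eqF.
  rewrite uE vE in UE *; rewrite !inver gt_eqF // (negbTE v0).
  case: UE => ->; rewrite muleAC muleC; congr (_ * _)%E.
  by rewrite -EFinM; congr EFin; field; rewrite v0 gt_eqF.
- move=> A mA; have : measurable_fun (f @` U) (fun x => mu (g x) (f @^-1` A)).
    apply: (@measurable_comp _ _ _ _ _ _ U (fun x => mu x (f @^-1` A)) _ g) => //.
    + by move=> _ [_ [x Ux <-] <-]; rewrite fK.
    + by apply: mmu; exact: pre.
    + exact: measurable_funTS.
  by [].
- have [N [mN N0 sN]] := aemu; exists (g @^-1` N); split.
  + exact: pre.
  + by rewrite /= /distribution /pushforward preE.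
  + move=> x /= nx; apply: sN => /= -[[M [mM M0 sM]] cst]; apply: nx; split.
      exists (g @^-1` M); split; first exact: pre.
        by rewrite /= /distribution /pushforward preE.
      move=> y /= ny; apply: sM => Wy; apply: ny; exists (g y) => //.
    move=> _ [v Wv <-] A mA; rewrite fK.
    by apply: cst => //; exact: pre.
- move=> A mA; rewrite [LHS]Pmu; last exact: pre.
  rewrite ge0_integral_pushforward //.
  + rewrite imE preE; apply: eq_integral => x _.
    by rewrite /= /distribution /pushforward fK.
  + apply: (@measurable_comp _ _ _ _ _ _ U (fun x => mu x (f @^-1` A)) _ g) => //.
    * by move=> _ [_ [x Ux <-] <-]; rewrite fK.
    * by apply: mmu; exact: pre.
    * exact: measurable_funTS.
Qed.

Section iterates.
Variables (R : realType) (F G : plane R -> plane R).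
Hypothesis FK : cancel F G.

Lemma iter_cancel (k : nat) : cancel (iter k F) (iter k G).
Proof. by elim: k => [//|k IH] z; rewrite iterSr iterS FK IH. Qed.

Lemma iter_continuous (k : nat) : continuous F -> continuous (iter k F).
Proof.
move=> cF; elim: k => [|k IH] z; first exact: cvg_id.
by apply: (continuous_comp (f := iter k F)); [exact: IH|exact: cF].
Qed.

Lemma stable_leaf_refl (z : plane R) : stable_leaf F z z.
Proof. by rewrite /stable_leaf /=; under eq_fun do rewrite subrr; exact: cvg_cst. Qed.

Lemma stable_leaf_sym (z w : plane R) : stable_leaf F z w -> stable_leaf F w z.
Proof.
move=> zw; rewrite /stable_leaf /= -oppr0.
rewrite (_ : (fun n => _) = (fun n => - (iter n F w - iter n F z))).
  exact: cvgN.
by apply/funext => n; rewrite opprB.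
Qed.

Lemma stable_leaf_trans (x y z : plane R) :
  stable_leaf F x y -> stable_leaf F y z -> stable_leaf F x z.
Proof.
move=> xy yz; rewrite /stable_leaf /= -[X in _ --> X]addr0.
rewrite (_ : (fun n => _) =
  (fun n => (iter n F z - iter n F y) + (iter n F y - iter n F x))).
  exact: cvgD.
by apply/funext => n; rewrite addrA subrK.
Qed.

Lemma stable_leaf_eq (z w : plane R) :
  stable_leaf F z w -> stable_leaf F w = stable_leaf F z.
Proof.
move=> zw; apply/seteqP; split => x h; first exact: stable_leaf_trans zw h.
exact: stable_leaf_trans (stable_leaf_sym zw) h.
Qed.

Lemma stable_leaf_map (z w : plane R) :
  stable_leaf F (F z) (F w) <-> stable_leaf F z w.
Proof.
have -> : stable_leaf F (F z) (F w) <->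
    (fun n => iter n.+1 F w - iter n.+1 F z) @ \oo --> (0 : plane R).
  rewrite /stable_leaf /=.
  rewrite (_ : (fun n => iter n F (F w) - _) =
    (fun n => F (iter n F w) - F (iter n F z))) //.
  by apply/funext => n; rewrite -!iterSr.
by rewrite (cvg_shiftS (fun n => iter n F w - iter n F z)).
Qed.

End iterates.

Lemma stable_leaf_iter {R : realType} (F G : plane R -> plane R) (k : nat)
    (z w : plane R) : cancel F G ->
  (stable_leaf F (iter k F z) (iter k F w) <-> stable_leaf F z w) /\
  (stable_leaf G (iter k F z) (iter k F w) <-> stable_leaf G z w).
Proof.
move=> FK; elim: k => [//|k [IH1 IH2]]; split.
  by rewrite -IH1 !iterS stable_leaf_map.
by rewrite -IH2 !iterS -(stable_leaf_map G) !FK.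
Qed.

Theorem lemma4p1 (R : realType) (f : torus R -> torus R)
    (F G : plane R -> plane R) (S : set (plane R)) (delta0 : R)
    (mc : nat -> mplane R -> probability (mplane R) R) :
  let Wu := stable_leaf G in
  let Ws := stable_leaf F in
  let B := Ws 0 in
  let strip k := iter k F @` strip0 B S Wu delta0 in
  let seg k x := Wu x `&` strip k in
  Anosov_endomorphism f ->
  torus_C2 f ->
  (exists J : R, forall x, `|det2 (torus_D f x)| = J) ->
  lift_of f F -> cancel F G -> cancel G F -> F 0 = 0 ->
  global_product_structure Ws Wu ->
  preserves_leaf_orientation Wu F ->
  UBD Wu ->
  (exists2 z, (~` B) z & S = connected_component (~` B) z) ->
  0 < delta0 ->
  torus_proj @` strip0 B S Wu delta0 = setT ->
  (forall k (O : set (plane R)), open O ->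
     bounded_set (B `&` O) -> B `&` O !=set0 ->
     disintegrates (strip k `&` proj_u B Wu @^-1` (B `&` O)) (seg k) (mc k)) ->
  forall k, {ae area, forall x, strip k x ->
    density_ae (mc k x) (pushforward (mc 0%N (iter k G x)) (iter k F))
      (fun r => r = 1%E)}.
Proof.
move=> Wu Ws B strip seg [_ det_neq0 _] C2f [J detJ] lF FK GK F0 gps _ _ _ _ _ mcP k.
have cF : continuous F by have [] := lF.
have cG : continuous G by exact: lift_inv_continuous lF FK GK F0.
have J0 : 0 < J.
  by rewrite -(detJ (torus_proj 0)) normr_gt0; exact: det_neq0.
have areaG A :=
  area_preimage FK GK J0 cG (fun z => lift_expansion z C2f detJ lF) (A := A).
have areaF (A : set (mplane R)) : measurable A ->
    area (F @^-1` A : set (mplane R)) = (J^-1%:E * area A)%E.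
  move=> mA; have mFA : measurable (F @^-1` A : set (mplane R)).
    by rewrite -[X in measurable X]setTI; exact: continuous_measurable_plane.
  have := areaG _ mFA.
  have -> : G @^-1` (F @^-1` A) = A.
    by apply/seteqP; split => z; rewrite /preimage /= GK.
  by move=> ->; rewrite muleA -EFinM mulVf ?mul1e // gt_eqF.
have areaFk j (A : set (mplane R)) : measurable A ->
    area (iter j F @^-1` A : set (mplane R)) = ((J^-1 ^+ j)%:E * area A)%E.
  elim: j A => [|j IH] A mA; first by rewrite expr0 mul1e.
  have mFA : measurable (F @^-1` A : set (mplane R)).
    by rewrite -[X in measurable X]setTI; exact: continuous_measurable_plane.
  by rewrite (IH _ mFA) areaF // muleA -EFinM exprSr.
pose Phi := iter k F; pose Psi := iter k G.
have PhiK : cancel Phi Psi by exact: iter_cancel.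
have PsiK : cancel Psi Phi by exact: iter_cancel.
have cPhi : continuous Phi by exact: iter_continuous.
have cPsi : continuous Psi by exact: iter_continuous.
pose mPhi : {mfun mplane R >-> mplane R} :=
  HB.pack (Phi : mplane R -> mplane R)
    (isMeasurableFun.Build _ _ _ _ _ (continuous_measurable_plane cPhi)).
have WuPhi z w : Wu (Phi z) (Phi w) <-> Wu z w.
  by have [] := stable_leaf_iter k z w FK.
have Phi0 : Phi 0 = 0 by rewrite /Phi; elim: (k) => // j IH; rewrite iterS IH F0.
have BPhi w : B (Phi w) <-> B w.
  by have [+ _] := stable_leaf_iter k 0 w FK; rewrite -/(Phi 0) Phi0.
pose pu := proj_u B Wu.
have puP z : Wu z (pu z) /\ B (pu z).
  have [y yE] := gps z 0; apply: (@getPex _ (Wu z `&` B)); exists y.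
  by change ((Wu z `&` Ws 0) y); rewrite yE.
have pu_unique z y : Wu z y -> B y -> pu z = y.
  move=> zy By; have [u uE] := gps z 0.
  have : (Wu z `&` B) (pu z) by exact: puP.
  have : (Wu z `&` B) y by [].
  by rewrite uE /= => -> ->.
have puPhi z : pu (Phi z) = Phi (pu z).
  by have [? ?] := puP z; apply: pu_unique; [exact/WuPhi|exact/BPhi].
have strip0E : strip 0%N = strip0 B S Wu delta0 by rewrite /strip image_id.
have imE (A : set (plane R)) : Phi @` A = Psi @^-1` A.
  apply/seteqP; split => [_ [x Ax <-]|x Ax]; first by rewrite /preimage /= PhiK.
  by exists (Psi x).
have segE x : Phi @` seg 0%N (Psi x) = seg k x.
  rewrite /seg strip0E imE; apply/seteqP; split => y [Wy Sy]; split.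
  - by have := (WuPhi (Psi x) (Psi y)).2 Wy; rewrite !PsiK.
  - by exists (Psi y).
  - by apply: (WuPhi _ _).1; rewrite !PsiK.
  - by case: Sy => v Sv <-; rewrite PhiK.
pose O (n : nat) : set (plane R) := ball 0 n.+1%:R.
have boxE (n : nat) : Phi @` (strip 0%N `&` pu @^-1` (B `&` O n)) =
    strip k `&` pu @^-1` (B `&` Phi @` O n).
  rewrite strip0E !imE; apply/seteqP; split => y.
  - move=> [Sy [By Oy]]; split; first by exists (Psi y).
    rewrite -(PsiK y) /preimage /= puPhi PhiK; split => //; exact/BPhi.
  - move=> [[v Sv <-]]; rewrite /preimage /= puPhi !PhiK => -[/BPhi Bv Ov].
    by split.
suff main (n : nat) : {ae area, forall x,
    (strip k `&` pu @^-1` (B `&` Phi @` O n)) x ->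
    forall A, measurable A -> mc k x A = distribution (mc 0%N (Psi x)) mPhi A}.
  have := ae_foralln main; apply: filterS => x xP Sx; apply: density_ae_eq1.
  have [v Sv vx] := Sx.
  have [Wv Bv] := puP v.
  pose n := Num.bound `|pu v|.
  apply: (xP n); split => //; rewrite /preimage /= -vx puPhi.
  split; first exact/BPhi.
  exists (pu v) => //; rewrite /O -ball_normE /= sub0r normrN.
  by rewrite (lt_trans (archi_boundP _)) // ltr_nat.
have B0 : B 0 by exact: stable_leaf_refl.
have O0 : O n 0 by exact: ballxx.
have bounded_image (Phi' : plane R -> plane R) : continuous Phi' ->
    bounded_set (B `&` Phi' @` O n).
  move=> cPhi'; pose r : R := n.+1%:R.
  have : compact (Phi' @` (`[- r, r] `*` `[- r, r])).
    apply: continuous_compact; last by apply: compact_setX; exact: segment_compact.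
    exact: continuous_subspaceT.
  move=> /compact_bounded; rewrite /bounded_set /= => -[M [Mreal MP]].
  exists M; split => // M' MM' _ [_ [x Ox <-]]; apply: MP MM' _ _; exists x => //.
  move: Ox; rewrite /O -ball_normE /= sub0r normrN => /ltW /plane_normP.
  by rewrite !ler_norml !in_itv.
have dis0 := mcP 0%N (O n) (ball_open _ _) _ _.
have disk := mcP k (Phi @` O n) _ _ _.
apply: (disintegrates_unique (W := seg k)).
- move=> x y [Sx [Bx Ox]] [Wy Sy]; split => //.
  have puE : pu y = pu x.
    have [? ?] := puP x; apply: pu_unique => //.
    by rewrite /Wu (stable_leaf_eq Wy).
  by rewrite /preimage /= -/(pu y) puE.
- apply: disk.
  + by rewrite imE; apply: open_comp (ball_open _ _) => // x _; exact: cPsi.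
  + exact: bounded_image cPhi.
  + by exists 0; split => //; exists 0.
- rewrite -[X in disintegrates X](boxE n) -(funext segE).
  apply: (disintegrates_image (f := mPhi) (K := J^-1 ^+ k)) => //.
  + exact: continuous_measurable_plane.
  + by rewrite exprn_gt0 // invr_gt0.
  + exact: areaFk.
  + apply: dis0.
      by have := @bounded_image id; rewrite image_id; apply => z; exact: cvg_id.
    by exists 0.
Qed.
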